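(* Let $G=G_1\cup G_2$ be the disjoint union of undirected graphs $G_1=(V_1,E_1)$ and $G_2=(V_2,E_2)$. Then $\operatorname{CIM}_G$ is affinely equivalent to $\operatorname{CIM}_{G_1}\times\operatorname{CIM}_{G_2}$.
   Context: For a DAG $\mathcal D$ on a finite node set $V$ the characteristic imset $c_{\mathcal D}$ is the vector indexed by all $S\subseteq V$, $|S|\ge2$, with $c_{\mathcal D}(S)=1$ if there is $i\in S$ such that all elements of $S\setminus\{i\}$ are parents of $i$ in $\mathcal D$, and $0$ otherwise. For an undirected graph $G$ on $V$, $\operatorname{CIM}_G=\operatorname{conv}(c_{\mathcal D}:\mathcal D\text{ a DAG on }V\text{ with skeleton (underlying undirected graph) }G)$. Two polytopes are affinely equivalent if there is an affine bijection between their affine hulls mapping one onto the other. *)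

(* Defs.v *)
From mathcomp Require Import all_boot all_order all_algebra.
From mathcomp Require Import boolp classical_sets functions reals convex.

Set Implicit Arguments.
Unset Strict Implicit.
Unset Printing Implicit Defensive.

Import Order.TTheory GRing.Theory Num.Theory.

Local Open Scope classical_set_scope.
Local Open Scope ring_scope.

Section Graphs.

Record ugraph (V : finType) := UGraph {
  edge :> rel V;
  edge_sym : symmetric edge;
  edge_irr : irreflexive edge }.

Definition is_dag (V : finType) (D : rel V) : Prop :=
  forall c : seq V, cycle D c -> c = [::].

Definition skeleton (V : finType) (D : rel V) : rel V :=
  fun x y => D x y || D y x.

Definition disj_edge (V1 V2 : finType) (e1 : rel V1) (e2 : rel V2) :
    rel (V1 + V2)%type :=
  fun x y => match x, y with
             | inl u, inl v => e1 u v
             | inr u, inr v => e2 u v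
             | _, _ => false
             end.

Lemma disj_edge_sym (V1 V2 : finType) (G1 : ugraph V1) (G2 : ugraph V2) :
  symmetric (disj_edge G1 G2).
Proof. by move=> [x|x] [y|y] //=; apply: edge_sym. Qed.

Lemma disj_edge_irr (V1 V2 : finType) (G1 : ugraph V1) (G2 : ugraph V2) :
  irreflexive (disj_edge G1 G2).
Proof. by move=> [x|x] /=; apply: edge_irr. Qed.

Definition disj_union (V1 V2 : finType) (G1 : ugraph V1) (G2 : ugraph V2) :
    ugraph (V1 + V2)%type :=
  UGraph (disj_edge_sym G1 G2) (disj_edge_irr G1 G2).

End Graphs.

Section Polytopes.
Variable R : realType.

Definition conv_hull (M : lmodType R) (A : set M) : set M :=
  smallest (@convex_set R M) A.

Definition affine_set (M : lmodType R) (A : set M) : Prop :=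
  forall (x y : M) (t : R), A x -> A y -> A (t *: x + (1 - t) *: y).

Definition aff_hull (M : lmodType R) (A : set M) : set M :=
  smallest (@affine_set M) A.

Definition affine_on (M N : lmodType R) (A : set M) (f : M -> N) : Prop :=
  forall (x y : M) (t : R), A x -> A y ->
    f (t *: x + (1 - t) *: y) = t *: f x + (1 - t) *: f y.

(* Only the restriction of [f] to the affine hull of [P] matters. *)
Definition affinely_equivalent (M N : lmodType R) (P : set M) (Q : set N) :
    Prop :=
  exists f : M -> N,
    [/\ affine_on (aff_hull P) f,
        set_bij (aff_hull P) (aff_hull Q) f
      & f @` P = Q].

End Polytopes.

Section CharacteristicImsets.
Variable R : realType.

Definition imset_index (V : finType) : finType :=
  {S : {set V} | (2 <= #|S|)%N}.

(* [D j i] is the arc j -> i, so [D^~ i] is the set of parents of [i]; [R^o]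
   makes the vectors an [lmodType R]. *)
Definition char_imset (V : finType) (D : rel V) : {ffun imset_index V -> R^o} :=
  [ffun S : imset_index V =>
    [exists i in val S, [forall j in val S :\ i, D j i]]%:R].

Definition CIM (V : finType) (G : ugraph V) : set {ffun imset_index V -> R^o} :=
  conv_hull [set c | exists D : rel V,
    [/\ is_dag D, skeleton D =2 G & c = char_imset D]].

End CharacteristicImsets.

Arguments char_imset R {V} D.
Arguments CIM R {V} G.

(* Main.v *)
Require Import Defs.
From mathcomp Require Import all_boot all_order all_algebra.
From mathcomp Require Import classical_sets reals.
From mathcomp Require Import boolp functions interval_inference convex.

(** Restricting an imset on [V1 + V2] to the subsets of [V1] and to the subsets
    of [V2] is a linear map.  A DAG whose skeleton is [G1 + G2] is exactly a pair
    of DAGs with skeletons [G1] and [G2], so this map carries the generators of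
    [CIM_G] onto the products of generators, and hulls commute with affine images
    and with products.  The map is injective on the affine hull because every
    characteristic imset of such a DAG vanishes on the sets meeting both [V1] and
    [V2]: a node of such a set is not adjacent to the nodes on the other side. *)

Set Implicit Arguments.
Unset Strict Implicit.
Unset Printing Implicit Defensive.

Import GRing.Theory Num.Theory.

Local Open Scope classical_set_scope.
Local Open Scope ring_scope.

(** * Convex and affine hulls under affine maps and products *)

Section Hulls.
Variable R : realType.

Lemma convex_setP (M : lmodType R) (A : set M) :
  convex_set A <->
  forall (x y : M) (t : R), 0 <= t <= 1 -> A x -> A y ->
    A (t *: x + (1 - t) *: y).
Proof.
split=> [cA x y t t01 Ax Ay|cA x y l /set_mem Ax /set_mem Ay].
  have t01' : Itv.spec (@Itv.num_sem R) (Itv.Real `[0%Z, 1%Z]) t.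
    by rewrite /= /Itv.num_sem /= ger0_real ?in_itv //; case/andP: t01.
  exact/set_mem/(cA x y (Itv.mk t01') (mem_set Ax) (mem_set Ay)).
apply/mem_set; apply: cA => //.
by apply/andP; split.
Qed.

Lemma affine_set_convex (M : lmodType R) (A : set M) :
  affine_set A -> convex_set A.
Proof. by move=> aA; apply/convex_setP => x y t _; apply: aA. Qed.

Lemma affine_aff_hull (M : lmodType R) (A : set M) : affine_set (aff_hull A).
Proof. by move=> x y t Ax Ay B BA; apply: BA.1; [apply: Ax|apply: Ay]. Qed.

Lemma conv_hull_conv (M : lmodType R) (A : set M) (x y : M) (t : R) :
  0 <= t <= 1 -> conv_hull A x -> conv_hull A y ->
  conv_hull A (t *: x + (1 - t) *: y).
Proof.
move=> t01 Ax Ay B BA.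
by apply: (convex_setP B).1 BA.1 _ _ _ t01 _ _; [apply: Ax|apply: Ay].
Qed.

Section AffineImage.
Variables (M N : lmodType R) (f : M -> N).
Hypothesis fA : affine_on setT f.

(** Preimages and images of affine sets under [f] are affine; minimality of each hull then gives one
    inclusion. *)
Lemma image_aff_hull (A : set M) : f @` aff_hull A = aff_hull (f @` A).
Proof.
apply/seteqP; split.
  apply/image_subP; apply: smallest_sub => [x y t /= Ax Ay|x Ax].
    by rewrite fA //; apply: affine_aff_hull.
  by apply: sub_gen_smallest; exists x.
apply: smallest_sub => [_ _ t [x Ax <-] [y Ay <-]|_ [x Ax <-]].
  by exists (t *: x + (1 - t) *: y); [apply: affine_aff_hull|rewrite fA].
by exists x => //; apply: sub_gen_smallest.
Qed.

Lemma image_conv_hull (A : set M) : f @` conv_hull A = conv_hull (f @` A).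
Proof.
apply/seteqP; split.
  apply/image_subP; apply: smallest_sub => [|x Ax].
    apply/convex_setP => x y t t01 /= Ax Ay.
    by rewrite fA //; apply: conv_hull_conv.
  by apply: sub_gen_smallest; exists x.
apply: smallest_sub => [|_ [x Ax <-]].
  apply/convex_setP => _ _ t t01 [x Ax <-] [y Ay <-].
  exists (t *: x + (1 - t) *: y); last by rewrite fA.
  by apply: conv_hull_conv.
by exists x => //; apply: sub_gen_smallest.
Qed.

End AffineImage.

(** A product of convex sets is convex, which gives one inclusion. For the other, slices of a convex
    set are convex, so one coordinate at a time is extended from generators to the hull: first [y]
    with [x] in [A], then [x]. *)
Lemma conv_hullX (M N : lmodType R) (A : set M) (B : set N) :
  conv_hull (A `*` B) = conv_hull A `*` conv_hull B.
Proof.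
apply/seteqP; split.
  apply: smallest_sub => [|[x y] [/= Ax By]]; last first.
    by split; apply: sub_gen_smallest.
  apply/convex_setP => -[x y] [x' y'] t t01 [/= Ax By] [/= Ax' By'].
  by split; apply: conv_hull_conv.
have AB (x : M) (y : N) :
    A x -> conv_hull B y -> conv_hull (A `*` B) (x, y).
  move=> Ax; move: y; apply: (@smallest_sub _ _ _
    [set y | conv_hull (A `*` B) (x, y)]) => [|y By]; last first.
    exact: sub_gen_smallest.
  apply/convex_setP => y y' t t01 /= Hy Hy'.
  rewrite (_ : (x, _) = t *: (x, y) + (1 - t) *: (x, y')); last first.
    by congr pair; rewrite /= -scalerDl addrC subrK scale1r.
  by apply: conv_hull_conv.
move=> [x y] [/= Ax By]; move: x Ax.
apply: (@smallest_sub _ _ _ [set x | conv_hull (A `*` B) (x, y)]) => [|x Ax].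
  apply/convex_setP => x x' t t01 /= Hx Hx'.
  rewrite (_ : (_, y) = t *: (x, y) + (1 - t) *: (x', y)); last first.
    by congr pair; rewrite /= -scalerDl addrC subrK scale1r.
  by apply: conv_hull_conv.
exact: AB.
Qed.

(** Surjectivity between the affine hulls is automatic because [f] commutes with [aff_hull]. *)
Lemma affinely_equivalent_image (M N : lmodType R) (f : M -> N) (P : set M) :
  affine_on setT f -> set_inj (aff_hull P) f -> affinely_equivalent P (f @` P).
Proof.
move=> fA f_inj; exists f; split=> //; first by move=> x y t _ _; apply: fA.
by rewrite -image_aff_hull //; split.
Qed.

End Hulls.

(** * Acyclicity of restrictions and disjoint unions *)

Section Dags.

Lemma is_dag_relpre (V W : finType) (h : V -> W) (D : rel W) :
  is_dag D -> is_dag (relpre h D).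
Proof.
by move=> dD c; rewrite -cycle_map => /dD; case: c.
Qed.

Variables (V1 V2 : finType) (D1 : rel V1) (D2 : rel V2).

Lemma path_disj_edge_inl (u : V1) (p : seq (V1 + V2)) :
  path (disj_edge D1 D2) (inl u) p -> exists2 q, p = map inl q & path D1 u q.
Proof.
elim: p u => [|[v|v] p IHp] u //=; first by exists [::].
by case/andP=> uv /IHp[q -> vq]; exists (v :: q); rewrite //= uv.
Qed.

Lemma path_disj_edge_inr (u : V2) (p : seq (V1 + V2)) :
  path (disj_edge D1 D2) (inr u) p -> exists2 q, p = map inr q & path D2 u q.
Proof.
elim: p u => [|[v|v] p IHp] u //=; first by exists [::].
by case/andP=> uv /IHp[q -> vq]; exists (v :: q); rewrite //= uv.
Qed.

Lemma is_dag_disj_edge : is_dag D1 -> is_dag D2 -> is_dag (disj_edge D1 D2).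
Proof.
move=> dD1 dD2 [|[u|u] p] //= cp.
  have [q Eq pq] := path_disj_edge_inl cp.
  (* The closed path runs along [rcons p (inl u)], so [q] is nonempty and ends in [u], which makes
     it a cycle of [D1] through [u]. *)
  case/lastP: q Eq pq => [|q v]; first by case: p {cp}.
  by rewrite map_rcons => /rcons_inj[_ <-] /(dD1 (u :: q)).
have [q Eq pq] := path_disj_edge_inr cp.
case/lastP: q Eq pq => [|q v]; first by case: p {cp}.
by rewrite map_rcons => /rcons_inj[_ <-] /(dD2 (u :: q)).
Qed.

End Dags.

(** * Restriction of imsets along an injection of nodes *)

Section Restriction.
Variables (R : realType) (V W : finType) (h : V -> W).
Hypothesis h_inj : injective h.

Fact card_imset_index (S : imset_index V) : (2 <= #|h @: val S|)%N.
Proof. by rewrite card_imset //; exact: (svalP S). Qed.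

Definition imset_push (S : imset_index V) : imset_index W :=
  exist _ (h @: val S) (card_imset_index S).

Definition imset_restr (c : {ffun imset_index W -> R^o}) :
    {ffun imset_index V -> R^o} := [ffun S => c (imset_push S)].

Lemma imset_restrD t x y :
  imset_restr (t *: x + (1 - t) *: y) =
  t *: imset_restr x + (1 - t) *: imset_restr y.
Proof. by apply/ffunP => S; rewrite !ffunE. Qed.

(** By injectivity, [h] carries [S] minus [i] onto the image of [S] minus [h i], so [i] is a witness
    for [S] exactly when [h i] is one for the image. *)
Lemma imset_restr_char (D : rel W) :
  imset_restr (char_imset R D) = char_imset R (relpre h D).
Proof.
apply/ffunP => S; rewrite !ffunE; congr (nat_of_bool _)%:R.
apply/exists_inP/exists_inP.
  move=> [_ /imsetP[i Si ->]] /forall_inP Di.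
  exists i => //; apply/forall_inP => j /setD1P[ji Sj] /=.
  by apply: Di; rewrite !inE (inj_eq h_inj) ji imset_f.
move=> [i Si] /forall_inP Di.
exists (h i); first exact: imset_f.
apply/forall_inP => x /setD1P[xi /imsetP[j Sj xE]].
by rewrite xE; apply: Di; rewrite !inE -(inj_eq h_inj) -xE xi.
Qed.

Lemma imset_pushP (S : imset_index W) :
  (forall x, x \in val S -> x \in codom h) -> exists S', S = imset_push S'.
Proof.
move=> Sh.
have E : h @: (h @^-1: val S) = val S.
  apply/setP => x; apply/imsetP/idP => [[y]|Sx]; first by rewrite inE => ? ->.
  by have /codomP[y xE] := Sh _ Sx; exists y; rewrite ?inE -?xE.
have S2 : (2 <= #|h @^-1: val S|)%N.
  by rewrite -(card_imset _ h_inj) E; exact: (svalP S).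
by exists (exist _ (h @^-1: val S) S2); apply: val_inj; rewrite /= E.
Qed.

End Restriction.

Arguments imset_restr R {V W h} h_inj.

Definition cim_gen (R : realType) (V : finType) (G : ugraph V) :
    set {ffun imset_index V -> R^o} :=
  [set c | exists D : rel V,
    [/\ is_dag D, skeleton D =2 G & c = char_imset R D]].

Arguments cim_gen R {V} G.

(** * Splitting imsets over the two sides *)

Section Split.
Variables (R : realType) (V1 V2 : finType) (G1 : ugraph V1) (G2 : ugraph V2).

Let inl_inj : injective (@inl V1 V2). Proof. by move=> x y []. Qed.
Let inr_inj : injective (@inr V1 V2). Proof. by move=> x y []. Qed.

Definition imset_split (c : {ffun imset_index (V1 + V2)%type -> R^o}) :
    {ffun imset_index V1 -> R^o} * {ffun imset_index V2 -> R^o} :=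
  (imset_restr R inl_inj c, imset_restr R inr_inj c).

Lemma imset_split_affine : affine_on setT imset_split.
Proof. by move=> x y t _ _; congr pair; apply: imset_restrD. Qed.

Lemma imset_split_gen :
  imset_split @` cim_gen R (disj_union G1 G2) = cim_gen R G1 `*` cim_gen R G2.
Proof.
apply/seteqP; split=> [_ [_ [D [dD sD ->]] <-]|[c1 c2] [/= [D1 [dD1 sD1 ->]]]].
  rewrite /imset_split !imset_restr_char; split.
    exists (relpre inl D); split=> //; first exact: is_dag_relpre.
    by move=> x y; apply: (sD (inl x) (inl y)).
  exists (relpre inr D); split=> //; first exact: is_dag_relpre.
  by move=> x y; apply: (sD (inr x) (inr y)).
case=> D2 [dD2 sD2 ->].
exists (char_imset R (disj_edge D1 D2)).
  exists (disj_edge D1 D2); split=> //; first exact: is_dag_disj_edge.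
  by move=> [x|x] [y|y] //=; [apply: sD1|apply: sD2].
(* Restricting [disj_edge D1 D2] to either side gives back [D1] or [D2] by computation. *)
by rewrite /imset_split !imset_restr_char.
Qed.

Definition unmixed (S : imset_index (V1 + V2)%type) : Prop :=
  (exists S1, S = imset_push inl_inj S1) \/
  (exists S2, S = imset_push inr_inj S2).

(** An explicit affine set around the affine hull of [CIM], on which injectivity can be checked
    coordinatewise. *)
Definition mixed_vanish : set {ffun imset_index (V1 + V2)%type -> R^o} :=
  [set c | forall S, ~ unmixed S -> c S = 0].

Lemma affine_mixed_vanish : affine_set mixed_vanish.
Proof.
by move=> x y t x0 y0 S mS; rewrite !ffunE x0 // y0 // !scaler0 addr0.
Qed.

Lemma imset_split_inj : set_inj mixed_vanish imset_split.
Proof.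
move=> x y /set_mem x0 /set_mem y0 [/ffunP E1 /ffunP E2]; apply/ffunP => S.
have [[[S' ->]|[S' ->]]|mS] := pselect (unmixed S).
- by have := E1 S'; rewrite !ffunE.
- by have := E2 S'; rewrite !ffunE.
- by rewrite x0 // y0.
Qed.

Lemma cim_gen_mixed_vanish : cim_gen R (disj_union G1 G2) `<=` mixed_vanish.
Proof.
move=> _ [D [_ sD ->]] S mS; rewrite ffunE; case: exists_inP => // -[i Si].
move=> /forall_inP Di; exfalso; apply: mS.
(* Parents of [i] are its neighbours in the skeleton, so all of [S] lies on the side of [i]. *)
have adj j : j \in val S -> j = i \/ disj_edge G1 G2 j i.
  move=> Sj; have [->|ji] := eqVneq j i; [by left|right].
  by rewrite -[disj_edge _ _ _ _]sD /skeleton Di // !inE ji.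
case: i {Si Di} adj => i adj; [left|right]; apply: imset_pushP.
  by move=> [j|j] /adj[] // _; apply: codom_f.
by move=> [j|j] /adj[] // _; apply: codom_f.
Qed.

End Split.

Theorem proposition3p1 (R : realType) (V1 V2 : finType)
  (G1 : ugraph V1) (G2 : ugraph V2) :
  affinely_equivalent (CIM R (disj_union G1 G2)) (CIM R G1 `*` CIM R G2).
Proof.
have splitA := @imset_split_affine R V1 V2.
have -> : CIM R G1 `*` CIM R G2 =
    @imset_split R V1 V2 @` CIM R (disj_union G1 G2).
  by rewrite /CIM image_conv_hull // imset_split_gen conv_hullX.
apply: affinely_equivalent_image => //.
apply: sub_in2 (@imset_split_inj R V1 V2) => x /set_mem Px; apply/mem_set.
(* Two hulls are peeled off: [mixed_vanish] is affine, so it suffices that it contains [CIM]; it is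
   also convex, so it suffices that it contains the generators. *)
apply: smallest_sub Px; first exact: affine_mixed_vanish.
apply: smallest_sub; last exact: cim_gen_mixed_vanish.
exact/affine_set_convex/affine_mixed_vanish.
Qed.
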